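(* Let $\Bbbk$ be a field of characteristic $0$. Let $G$ be a graph with vertex set $[2m]=\{1,\dots,2m\}$ such that $\tau(G)=m$. Assume that $G$ has two complementary minimum vertex covers $O$ and $E$, that is, $O\cap E=\emptyset$, $O\cup E=[2m]$ and $|O|=|E|=m$. If $c_m(G)\le \mathrm{Cat}_m$, then $A_{\mathrm c}(G)$ does not have the weak Lefschetz property (WLP).
   Context: Graphs are finite and simple and have at least one edge. A vertex cover of a graph $G$ is a set of vertices meeting every edge; $\tau(G)$ is the minimum cardinality of a vertex cover, and a minimum vertex cover is one of cardinality $\tau(G)$; $c_d(G)$ is the number of vertex covers of $G$ of cardinality $d$. $\mathrm{Cat}_m=\frac1{m+1}\binom{2m}{m}$. For a graph $G$ on $[n]$, let $R=\Bbbk[x_1,\dots,x_n]$ with the standard grading, $x_C=\prod_{i\in C}x_i$, $J(G)=(x_C : C\text{ a vertex cover of }G)\subset R$, and $A_{\mathrm c}(G)=R/\big((x_1^2,\dots,x_n^2)+J(G)\big)$. A standard graded Artinian $\Bbbk$-algebra $A=\bigoplus_i[A]_i$ has the WLP if there is a linear form $\ell\in[A]_1$ such that for every $i$ the multiplication map $\cdot\ell:[A]_i\to[A]_{i+1}$ is injective or surjective. *)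

(* Defs.v *)
From HB Require Import structures.
From mathcomp Require Import all_boot all_order all_algebra.
From mathcomp Require boolp.
From mathcomp Require Import mpoly.

Set Implicit Arguments.
Unset Strict Implicit.
Unset Printing Implicit Defensive.

Import GRing.Theory.
Local Open Scope ring_scope.
Local Open Scope quotient_scope.

(* The graphs considered have at least one edge. *)
Record graph (n : nat) := Graph {
  edge : rel 'I_n;
  edge_sym : ssrbool.symmetric edge;
  edge_irr : irreflexive edge;
  edge_ex : exists u v, edge u v
}.

Section Covers.
Variables (n : nat) (G : graph n).
Implicit Types C : {set 'I_n}.

Definition vertex_cover C : bool :=
  [forall u, forall v, edge G u v ==> (u \in C) || (v \in C)].

Lemma vertex_coverT : vertex_cover [set: 'I_n].
Proof. by apply/forallP=> u; apply/forallP=> v; rewrite !inE implybT. Qed.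

(* The argmin is meaningful because [set: 'I_n] is a cover (vertex_coverT). *)
Definition cover_number : nat :=
  #|[arg min_(C < [set: 'I_n] | vertex_cover C) #|C|]|.

Lemma cover_number_min C : vertex_cover C -> (cover_number <= #|C|)%N.
Proof.
by rewrite /cover_number; case: arg_minnP => [|D _ minD]; [exact: vertex_coverT | exact: minD].
Qed.

Lemma cover_number_ex : exists2 C, vertex_cover C & #|C| = cover_number.
Proof.
rewrite /cover_number; case: arg_minnP => [|D coverD _]; first exact: vertex_coverT.
by exists D.
Qed.

Definition min_vertex_cover C : bool :=
  vertex_cover C && (#|C| == cover_number).

Definition num_covers (d : nat) : nat :=
  #|[set C : {set 'I_n} | vertex_cover C & #|C| == d]|.

Lemma vertex_cover_neq0 C : vertex_cover C -> C != set0.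
Proof.
have [u [v uv]] := edge_ex G; apply: contraTneq => ->.
by apply/negP => /forallP/(_ u)/forallP/(_ v); rewrite uv !inE.
Qed.

End Covers.

(* The quotient is exact: see Catalan_mul. *)
Definition Catalan (m : nat) : nat := ('C(2 * m, m) %/ m.+1)%N.

Lemma Catalan_mul m : (m.+1 * Catalan m = 'C(2 * m, m))%N.
Proof.
rewrite mulnC divnK // mul2n -addnn.
have E : (m.+1 * 'C(m + m, m.+1) = m * 'C(m + m, m))%N.
  by rewrite mul_bin_left addnK.
have : (m.+1 %| m * 'C(m + m, m))%N by rewrite -E dvdn_mulr.
by rewrite Gauss_dvdr // coprimeSn.
Qed.

Section Ideals.
Variable R : comNzRingType.

Definition ideal_gen (S : R -> Prop) (f : R) : Prop :=
  exists2 r : seq (R * R),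
    forall c, c \in r -> S c.2 & f = \sum_(c <- r) c.1 * c.2.

Definition ideal_sum (I J : R -> Prop) (f : R) : Prop :=
  exists g h, [/\ I g, J h & f = g + h].

Lemma ideal_gen0 S : ideal_gen S 0.
Proof. by exists [::] => //; rewrite big_nil. Qed.

Lemma ideal_genMD S a f g :
  ideal_gen S f -> ideal_gen S g -> ideal_gen S (a * f + g).
Proof.
case=> [r Sr ->] [s Ss ->]; exists ([seq (a * c.1, c.2) | c <- r] ++ s).
  by move=> c; rewrite mem_cat => /orP[/mapP[d /Sr Sd ->]|/Ss].
rewrite big_cat big_map mulr_sumr; congr (_ + _).
by apply: eq_bigr => c _; rewrite mulrA.
Qed.

End Ideals.

Section CoverAlgebra.
Variables (k : fieldType) (n : nat) (G : graph n).

Definition var_square (f : {mpoly k[n]}) : Prop := exists i, f = 'X_i ^+ 2.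

Definition cover_monomial (f : {mpoly k[n]}) : Prop :=
  exists2 C : {set 'I_n}, vertex_cover G C & f = \prod_(i in C) 'X_i.

(* The ideal J(G). *)
Definition cover_ideal : {mpoly k[n]} -> Prop := ideal_gen cover_monomial.

(* The ideal (x_1^2, ..., x_n^2) + J(G). *)
Definition Ac_ideal : {pred {mpoly k[n]}} :=
  fun f => boolp.asbool (ideal_sum (ideal_gen var_square) cover_ideal f).

Lemma Ac_idealP f :
  reflect (ideal_sum (ideal_gen var_square) cover_ideal f) (f \in Ac_ideal).
Proof. exact: boolp.asboolP. Qed.

Let ev0 : {mpoly k[n]} -> k := meval (fun=> 0).

Let ideal_gen_ev0 S f : (forall g, S g -> ev0 g = 0) -> ideal_gen S f -> ev0 f = 0.
Proof.
move=> S0 [r Sr ->]; rewrite /ev0 raddf_sum /= big_seq big1 // => c /Sr /S0.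
by rewrite mevalM /ev0 => ->; rewrite mulr0.
Qed.

(* Properness is where the existence of an edge is used. *)
Lemma Ac_ideal_closed : idealr_closed Ac_ideal.
Proof.
split.
- apply/Ac_idealP; exists 0, 0; split; [exact: ideal_gen0| exact: ideal_gen0|].
  by rewrite addr0.
- apply/negP => /Ac_idealP[g [h [Ig Jh E]]].
  have g0 : ev0 g = 0.
    by apply: ideal_gen_ev0 Ig => _ [i ->]; rewrite /ev0 rmorphXn /= mevalXU expr0n.
  have h0 : ev0 h = 0.
    apply: ideal_gen_ev0 Jh => _ [C /vertex_cover_neq0/set0Pn[i iC] ->].
    by rewrite /ev0 (bigD1 i) //= mevalM mevalXU mul0r.
  have : ev0 1 = 0 by rewrite E /ev0 mevalD -/(ev0 g) -/(ev0 h) g0 h0 addr0.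
  by rewrite /ev0 meval1 => /eqP; rewrite oner_eq0.
- move=> a f f' /Ac_idealP[g [h [Ig Jh ->]]] /Ac_idealP[g' [h' [Ig' Jh' ->]]].
  apply/Ac_idealP; exists (a * g + g'), (a * h + h').
  split; [exact: ideal_genMD | exact: ideal_genMD |].
  by rewrite mulrDr addrACA.
Qed.

HB.instance Definition _ := isIdealr.Build {mpoly k[n]} Ac_ideal Ac_ideal_closed.

Definition Ac : comNzRingType := {ideal_quot Ac_ideal}.

(* [A_c(G)]_i, the image of the forms of degree i. *)
Definition Ac_deg (i : nat) (a : Ac) : Prop :=
  exists2 f : {mpoly k[n]}, f \is i.-homog & a = \pi_{ideal_quot Ac_ideal} f.

End CoverAlgebra.

(* Weak Lefschetz property of the ring A with graded pieces deg i; since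
   l * (-) is additive, its kernel and image are those of a linear map as soon
   as A is a graded algebra over a field. *)
Definition WLP (A : comNzRingType) (deg : nat -> A -> Prop) : Prop :=
  exists2 l : A, deg 1%N l &
    forall i : nat,
      (forall a b, deg i a -> deg i b -> l * a = l * b -> a = b) \/
      (forall c, deg i.+1 c -> exists2 a, deg i a & l * a = c).

(* Main.v *)
Require Import Defs.
From mathcomp Require Import all_boot all_order all_algebra.
From mathcomp Require Import mpoly ring.

(** Modulo the ideal of A_c(G), a polynomial is determined by its coefficients
    at the squarefree monomials x_S with S not a vertex cover. Take degrees
    m - 1 and m. No cover has m - 1 elements and c_m(G) <= Cat_m, so
    dim [A]_(m-1) = binom(2m, m-1) = binom(2m, m) - Cat_m <= dim [A]_m, and it
    suffices to show that no linear form l is injective on [A]_(m-1). Write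
    l = L_O + L_E with L_O, L_E supported on O and E. Modulo squares,
    l * sum_j L_O^j (- L_E)^(m-1-j) = L_O^m - (- L_E)^m is a combination of x_O
    and x_E, hence zero in A, and the cofactor of l is nonzero if l involves at
    least m - 1 variables. Otherwise all variables of l divide a squarefree
    monomial of degree m - 1, which l kills. *)

Set Implicit Arguments.
Unset Strict Implicit.
Unset Printing Implicit Defensive.

Import GRing.Theory.

(** * Squarefree coordinates on $A_{\mathrm c}(G)$ and multiplication by a linear form *)

Section Coordinates.
Local Open Scope ring_scope.
Local Open Scope quotient_scope.
Variables (k : fieldType) (n : nat).
Implicit Types (f g l : {mpoly k[n]}) (S T C D : {set 'I_n}) (u : 'X_{1..n}).

Lemma mcoeffMX_notle f u (t : 'X_{1..n}) :
  ~~ (u <= t)%MM -> (f * 'X_[u])@_t = 0.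
Proof.
move=> ut; apply/eqP; rewrite mcoeff_eq0 (perm_mem (msuppMX _ _)).
by apply: contra ut => /mapP[w _ ->]; exact: lem_addr.
Qed.

Lemma prod_mpolyX_set C : \prod_(i in C) 'X_i = 'X_[mesym1 C] :> {mpoly k[n]}.
Proof.
rewrite mprodXE; congr 'X_[_]; apply/mnmP => j; rewrite mnmE mnm_sumE.
have [jC|jC] := boolP (j \in C).
  rewrite (bigD1 j) //= mnm1E eqxx big1 // => i /andP[_ ij].
  by rewrite mnm1E (negbTE ij).
by rewrite big1 // => i iC; rewrite mnm1E (negbTE (memPn jC i iC)).
Qed.

Lemma mesym1_le S T : (mesym1 S <= mesym1 T)%MM = (S \subset T).
Proof.
apply/mnm_lepP/subsetP => ST i.
  by move=> iS; have := ST i; rewrite !mnmE iS; case: (i \in T).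
by rewrite !mnmE; case: (boolP (i \in S)) => // /ST ->.
Qed.

Lemma mesym1D1 S i : i \in S -> mesym1 S = (U_(i) + mesym1 (S :\ i))%MM.
Proof.
move=> iS; apply/mnmP => j; rewrite mnmDE !mnmE !inE [j == i]eq_sym.
by case: eqP => [<-|_]; rewrite ?iS ?add0n.
Qed.

Lemma mnm_squarefree_or u :
  (exists i, (U_(i) *+ 2 <= u)%MM) \/ (exists S, u = mesym1 S).
Proof.
have [/forallP le1|/forallPn[i]] := boolP [forall i, u i <= 1]%N.
  right; exists [set i | u i == 1%N]; apply/mnmP => i; rewrite mnmE inE.
  by have := le1 i; case: (u i) => [|[]].
rewrite -ltnNge => ui; left; exists i; apply/mnm_lepP => j.
by rewrite mulmnE mnm1E; case: eqP => [<-|_]; rewrite ?mul1n ?mul0n.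
Qed.

(** A linear form is a combination of variables, and $x_i f$ contributes to $x_S$ only if $i\in S$,
    through the term $x_{S\setminus i}$ of $f$. *)
Lemma mcoeff_linearM l f S : l \is 1.-homog ->
  (l * f)@_(mesym1 S) = \sum_(i in S) l@_U_(i) * f@_(mesym1 (S :\ i)).
Proof.
move=> l1; have lE : l = \sum_i l@_U_(i) *: 'X_i.
  apply/mpolyP => u; rewrite raddf_sum /=.
  have [/mdeg1P[j /eqP ->]|u1] := boolP (mdeg u == 1%N).
    rewrite (bigD1 j) //= mcoeffZ mcoeffX eqxx mulr1 big1 ?addr0 // => i ij.
    by rewrite mcoeffZ mcoeffX eq_mnm1 (negbTE ij) mulr0.
  rewrite (dhomog_nemf_coeff l1 u1) big1 // => i _; rewrite mcoeffZ mcoeffX.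
  by case: eqP => [E|]; [rewrite -E mdeg1 in u1 | rewrite mulr0].
rewrite {1}lE mulr_suml raddf_sum [RHS]big_mkcond; apply: eq_bigr => i _ /=.
rewrite -scalerAl mcoeffZ [_ * f]mulrC; case: ifP => iS.
  by rewrite (mesym1D1 iS) mcoeffMX.
rewrite mcoeffMX_notle ?mulr0 //; apply/negP => /mnm_lepP/(_ i).
by rewrite !mnmE eqxx iS.
Qed.

Variable G : graph n.

Lemma vertex_coverS C D : C \subset D -> vertex_cover G C -> vertex_cover G D.
Proof.
move=> /subsetP CD /forallP cC; apply/forallP=> u; apply/forallP => v.
apply/implyP => uv; have /forallP/(_ v)/implyP/(_ uv) := cC u.
by case/orP => /CD ->; rewrite ?orbT.
Qed.

(** The ideal is monomial, and covers are closed under supersets, so the monomials outside it are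
    exactly the $x_S$ with $S$ not a cover. *)
Lemma Ac_idealP_mcoeff f :
  reflect (forall S, ~~ vertex_cover G S -> f@_(mesym1 S) = 0)
    (f \in @Ac_ideal k n G).
Proof.
apply: (iffP idP) => [/Ac_idealP[g [h [[r Sr ->] [s Ss ->] ->]]] S ncS|f0].
  rewrite mcoeffD !raddf_sum /= big_seq big1 => [|c /Sr[i ->]].
    rewrite add0r big_seq big1 // => c /Ss[C coverC ->].
    rewrite prod_mpolyX_set mcoeffMX_notle // mesym1_le.
    by apply: contra ncS => /vertex_coverS; apply.
  rewrite mpolyXn mcoeffMX_notle //; apply/negP => /mnm_lepP/(_ i).
  by rewrite mulmnE !mnmE eqxx; case: (i \in S).
have gen1 (P : {mpoly k[n]} -> Prop) g : P g -> ideal_gen P g.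
  move=> Pg; exists [:: (1, g)]; last by rewrite big_seq1 mul1r.
  by move=> c; rewrite inE => /eqP ->.
rewrite [f]mpolyE rpred_sum // => u _; rewrite -mul_mpolyC.
have [[i iu]|[S uS]] := mnm_squarefree_or u.
  rewrite -(submK iu) mpolyXD mulrA; apply: idealMr.
  apply/Ac_idealP; exists ('X_i ^+ 2), 0; split; last by rewrite addr0 mpolyXn.
    by apply: gen1; exists i.
  exact: ideal_gen0.
rewrite uS; have [coverS|/f0 ->] := boolP (vertex_cover G S); last first.
  by rewrite mpolyC0 mul0r rpred0.
apply: idealMr; apply/Ac_idealP; exists 0, 'X_[mesym1 S].
split; [exact: ideal_gen0 | | by rewrite add0r].
by apply: gen1; exists S; rewrite // prod_mpolyX_set.
Qed.

Lemma Ac_eqP f g :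
  (\pi_{ideal_quot (@Ac_ideal k n G)} f =
     \pi_{ideal_quot (@Ac_ideal k n G)} g :> Ac k G) <->
  (forall S, ~~ vertex_cover G S -> f@_(mesym1 S) = g@_(mesym1 S)).
Proof.
split=> [/eqP E S ncS|E].
  move: E; rewrite -Quotient.idealrBE => /Ac_idealP_mcoeff/(_ S ncS).
  by rewrite mcoeffB => /eqP; rewrite subr_eq0 => /eqP.
apply/eqP; rewrite -Quotient.idealrBE; apply/Ac_idealP_mcoeff => S ncS.
by rewrite mcoeffB E ?subrr.
Qed.

Definition noncovers (d : nat) : {set {set 'I_n}} :=
  [set S | ~~ vertex_cover G S & #|S| == d].

Lemma noncoversD1 d S i :
  S \in noncovers d.+1 -> i \in S -> S :\ i \in noncovers d.
Proof.
rewrite !inE => /andP[ncS /eqP cS] iS; apply/andP; split.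
  by apply: contra ncS; apply: vertex_coverS; rewrite subD1set.
by move: cS; rewrite (cardsD1 i) iS add1n => -[->].
Qed.

(* As dim [A]_d <= dim [A]_(d+1), surjectivity would force injectivity; v is
   the family of coordinates of an element of [A]_d. *)
Lemma WLP_injective d :
  (#|noncovers d| <= #|noncovers d.+1|)%N -> WLP (@Ac_deg k n G) ->
  exists a : 'I_n -> k, forall v : {set 'I_n} -> k,
    (forall S, S \in noncovers d.+1 -> \sum_(i in S) a i * v (S :\ i) = 0) ->
    forall T, T \in noncovers d -> v T = 0.
Proof.
move=> le_dim [_ [l l1 ->]] /(_ d) lefschetz.
exists (fun i => l@_U_(i)) => v kerv T Td.
case: lefschetz => [inj|surj].
  (* In the injective case, the form with coordinates [v] is killed by [l] in the quotient, so it is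
     zero there. *)
  pose f : {mpoly k[n]} := \sum_(S in noncovers d) v S *: 'X_[mesym1 S].
  have fE S : f@_(mesym1 S) = if S \in noncovers d then v S else 0.
    rewrite raddf_sum /=; case: ifP => Sd.
      rewrite (bigD1 S) //= mcoeffZ mcoeffX eqxx mulr1.
      rewrite big1 ?addr0 // => U /andP[_ US].
      by rewrite mcoeffZ mcoeffX (inj_eq (@inj_mesym1 n)) (negbTE US) mulr0.
    rewrite big1 // => U Ud; rewrite mcoeffZ mcoeffX (inj_eq (@inj_mesym1 n)).
    by case: eqP Sd => [<-|]; rewrite ?Ud ?mulr0.
  have fd : f \is d.-homog.
    apply: rpred_sum => S; rewrite inE => /andP[_ /eqP cS].
    by rewrite dhomogZ // dhomogX /= mdeg_mesym1 cS.
  have f0 : \pi_{ideal_quot (@Ac_ideal k n G)} f =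
            \pi_{ideal_quot (@Ac_ideal k n G)} 0 :> Ac k G.
    apply: inj; [by exists f | by exists 0; rewrite // dhomog0 |].
    rewrite -!rmorphM mulr0; apply/Ac_eqP => S ncS.
    rewrite mcoeff0 mcoeff_linearM //.
    have [cS|cS] := eqVneq #|S| d.+1.
      have Sd : S \in noncovers d.+1 by rewrite inE ncS cS /=.
      rewrite -[RHS](kerv S Sd); apply: eq_bigr => i iS.
      by rewrite fE noncoversD1.
    apply: big1 => i iS; rewrite fE inE andbC.
    by move: cS; rewrite (cardsD1 i) iS add1n eqSS => /negbTE ->; rewrite mulr0.
  have := fE T; rewrite Td => <-; rewrite ((Ac_eqP _ _).1 f0) ?mcoeff0 //.
  by move: Td; rewrite inE => /andP[].
(* The matrix of multiplication by [l] from $[A]_d$ to $[A]_{d+1}$ in the monomial bases, acting on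
   row vectors. *)
pose M : 'M[k]_(#|noncovers d|, #|noncovers d.+1|) :=
  \matrix_(r, c) \sum_(i in (enum_val c : {set 'I_n}))
    l@_U_(i) * (enum_val r == enum_val c :\ i)%:R.
have mulME (w : {set 'I_n} -> k) c : ((\row_r w (enum_val r)) *m M) 0 c =
    \sum_(i in (enum_val c : {set 'I_n})) l@_U_(i) * w (enum_val c :\ i).
  rewrite mxE; under eq_bigr => r _ do rewrite !mxE mulr_sumr.
  rewrite exchange_big /=; apply: eq_bigr => i ic.
  rewrite -(big_enum_val (fun T => w T * (l@_U_(i) * (T == enum_val c :\ i)%:R))) /=.
  rewrite (bigD1 (enum_val c :\ i)) ?(noncoversD1 (enum_valP c)) //=.
  rewrite eqxx mulr1 mulrC big1 ?addr0 // => U /andP[_ /negbTE ->].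
  by rewrite !mulr0.
have : row_full M.
  rewrite -sub1mx; apply/row_subP => c; apply/submxP.
  have := surj (\pi_{ideal_quot (@Ac_ideal k n G)} 'X_[mesym1 (enum_val c)]).
  case=> [|_ [f fd ->]].
    exists 'X_[mesym1 (enum_val c)] => //; rewrite dhomogX /= mdeg_mesym1.
    by have := enum_valP c; rewrite inE => /andP[].
  rewrite -rmorphM => /Ac_eqP lf.
  exists (\row_r f@_(mesym1 (enum_val r))); apply/rowP => e.
  rewrite (mulME (fun S => f@_(mesym1 S))) -mcoeff_linearM // lf; last first.
    by have := enum_valP e; rewrite inE => /andP[].
  by rewrite !mxE mcoeffX (inj_eq (@inj_mesym1 n)) (inj_eq enum_val_inj).
(* The rank is $\dim[A]_{d+1}\ge\dim[A]_d$, so the rows are independent. *)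
move=> /eqP rkM; have freeM : row_free M.
  by rewrite /row_free eqn_leq rank_leq_row rkM.
have v0 : \row_r v (enum_val r) = 0 :> 'rV_#|noncovers d|.
  apply: (row_free_inj freeM); rewrite mul0mx; apply/rowP => c.
  by rewrite mulME mxE kerv // enum_valP.
have := congr1 (fun w : 'rV_#|noncovers d| => w 0 (enum_rank_in Td T)) v0.
by rewrite !mxE enum_rankK_in.
Qed.

End Coordinates.

(** * Kernel vectors for an arbitrary linear form *)

Section LinearFormKernels.
Local Open Scope ring_scope.
Variables (k : fieldType) (I : finType) (a : I -> k).
Implicit Types S T O : {set I}.

Lemma subset_of_card (A : {set I}) d :
  (d <= #|A|)%N -> exists2 T : {set I}, T \subset A & #|T| = d.
Proof.
move=> /card_geqP[s [uniqs <- sA]]; exists [set x in s].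
  by apply/subsetP => x; rewrite inE; exact: sA.
by rewrite cardsE; apply/card_uniqP.
Qed.

Lemma superset_of_card (A : {set I}) d :
  (#|A| <= d <= #|I|)%N -> exists2 T : {set I}, A \subset T & #|T| = d.
Proof.
move=> /andP[Ad dI]; have [|T TA cT] := @subset_of_card (~: A) (#|I| - d).
  by rewrite -(cardsC A) leq_subLR leq_add2r.
exists (~: T); first by rewrite -setCS setCK.
by rewrite -(subKn dI) -cT -(cardsC T) addKn.
Qed.

(** If every variable of the linear form divides $x_T$, each term of its product with $x_T$ contains
    a square. *)
Lemma kernel_small_support T S : (forall i, i \notin T -> a i = 0) ->
  \sum_(i in S) a i * (S :\ i == T)%:R = 0.
Proof.
move=> aT; apply: big1 => i iS; have [E|] := eqVneq; last by rewrite mulr0.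
by rewrite aT ?mul0r // -E !inE eqxx.
Qed.

(* The coefficient at x_T, modulo squares, of sum_j L_O^j (- L_E)^(d-j), where
   d = #|T| and E is the complement of O. *)
Definition geometric_coef O T : k :=
  (-1) ^+ #|T :\: O| * (#|T :&: O|`! * #|T :\: O|`!)%:R * \prod_(i in T) a i.

(** Let $x=|S\cap O|$ and $y=|S\setminus O|$, both positive. Up to the factor $\prod_{i\in S}a_i$,
    the first part gives $x$ terms $(-1)^y(x-1)!\,y!$ and the second $y$ terms
    $(-1)^{y-1}x!\,(y-1)!$; the two sums cancel. *)
Lemma kernel_geometric O S : S :&: O != set0 -> S :\: O != set0 ->
  \sum_(i in S) a i * geometric_coef O (S :\ i) = 0.
Proof.
rewrite -!card_gt0 => xgt0 ygt0; rewrite (big_setID O) /=.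
under eq_bigr => i /setIP[iS iO].
  rewrite /geometric_coef setIDAC setDDl setUC -setDDl.
  have -> : (S :\: O) :\ i = S :\: O.
    by apply/setDidPl; rewrite disjoint_sym disjoints1 !inE iO.
  have -> : #|(S :&: O) :\ i| = #|S :&: O|.-1.
    by rewrite (cardsD1 i (S :&: O)) !inE iS iO.
  rewrite mulrCA -(big_setD1 i iS) /=; over.
under [X in _ + X]eq_bigr => i /setDP[iS iO].
  rewrite /geometric_coef setIDAC setDDl setUC -setDDl.
  have -> : (S :&: O) :\ i = S :&: O.
    by apply/setDidPl; rewrite disjoint_sym disjoints1 !inE (negbTE iO) andbF.
  have -> : #|(S :\: O) :\ i| = #|S :\: O|.-1.
    by rewrite (cardsD1 i (S :\: O)) !inE iS iO.
  rewrite mulrCA -(big_setD1 i iS) /=; over.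
rewrite !sumr_const; case: #|_| xgt0 => // x _; case: #|_| ygt0 => // y _ /=.
rewrite exprS !factS -[X in X + _]mulr_natr -[X in _ + X]mulr_natr !natrM.
move: (x.+1)%:R (y.+1)%:R (x`!)%:R (y`!)%:R ((-1) ^+ y) => x1 y1 fx fy s; ring.
Qed.

(** Characteristic zero keeps the factorials nonzero in [k]. *)
Lemma geometric_coef_neq0 O T : [pchar k] =i pred0 ->
  (forall i, i \in T -> a i != 0) -> geometric_coef O T != 0.
Proof.
move=> /pcharf0P k0 aT; rewrite !mulf_neq0 ?signr_eq0 //.
  by rewrite k0 -lt0n muln_gt0 !fact_gt0.
by apply/prodf_neq0.
Qed.

Lemma exists_kernel d O : [pchar k] =i pred0 ->
    (d <= #|I|)%N -> #|O| = d.+1 -> #|~: O| = d.+1 ->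
  exists v : {set I} -> k,
    (forall S, #|S| = d.+1 -> S != O -> S != ~: O ->
       \sum_(i in S) a i * v (S :\ i) = 0) /\
    exists2 T : {set I}, #|T| = d & v T != 0.
Proof.
move=> k0 dI cO cE; have [le_d|ge_d] := leqP #|[set i | a i != 0]| d.
  have [|T /subsetP ZT cT] := @superset_of_card [set i | a i != 0] d.
    by rewrite le_d.
  exists (fun U => (U == T)%:R); split; last first.
    by exists T; rewrite // eqxx oner_eq0.
  move=> S _ _ _; apply: kernel_small_support => i; apply: contraNeq => ai.
  by apply: ZT; rewrite inE.
have [T /subsetP TZ cT] := subset_of_card (ltnW ge_d).
exists (geometric_coef O); split; last first.
  exists T => //; apply: geometric_coef_neq0 => // i /TZ.
  by rewrite inE.
(* By cardinality, a $(d+1)$-set contained in [O] or in its complement equals it; any other meets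
   both. *)
move=> S cS SO SE; apply: kernel_geometric.
  apply: contra SE => /eqP SO0; rewrite eqEcard cS cE leqnn andbT.
  by rewrite -disjoints_subset -setI_eq0 SO0.
apply: contra SO; rewrite setD_eq0 => SsubO.
by rewrite eqEcard cS cO leqnn andbT.
Qed.

End LinearFormKernels.

(** * Dimension count and conclusion *)

Lemma binS_Catalan p : 'C(2 * p.+1, p) + Catalan p.+1 = 'C(2 * p.+1, p.+1).
Proof.
(* After multiplying by $p+2$, use $(p+1)\binom{2p+2}{p+1}=(p+2)\binom{2p+2}{p}$. *)
apply/eqP; rewrite -(eqn_pmul2l (ltn0Sn p.+1)) mulnDr Catalan_mul.
have := mul_bin_left (2 * p.+1) p.
have -> : 2 * p.+1 - p = p.+2 by rewrite mul2n -addnn addSnnS addnC addnK.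
by move=> <-; rewrite -mulSnr.
Qed.

Lemma card_noncovers n (G : graph n) d :
  num_covers G d + #|noncovers G d| = 'C(n, d).
Proof.
rewrite -[n in RHS]card_ord -card_draws.
rewrite -[RHS](cardsID [set C | vertex_cover G C]).
by congr (_ + _); apply: eq_card => S; rewrite !inE // andbC.
Qed.

Theorem proposition3p13 (k : fieldType) (char_k : [pchar k]%R =i pred0)
  (m : nat) (G : graph (2 * m)) (tauG : cover_number G = m)
  (O E : {set 'I_(2 * m)})
  (minO : min_vertex_cover G O) (minE : min_vertex_cover G E)
  (OE0 : O :&: E = set0) (OET : O :|: E = [set: 'I_(2 * m)])
  (cardO : #|O| = m) (cardE : #|E| = m)
  (cm : num_covers G m <= Catalan m) :
  ~ WLP (@Ac_deg k (2 * m) G).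
Proof.
(* An edge needs a vertex, so $m>0$ and the degree $p=m-1$ makes sense. *)
have [p mE] : exists p, m = p.+1.
  case: m G {tauG O E minO minE OE0 OET cardO cardE cm} => [G|p _].
    by have [[]] := edge_ex G.
  by exists p.
subst m; have nc_p (T : {set 'I_(2 * p.+1)}) : #|T| = p -> T \in noncovers G p.
  move=> cT; rewrite inE cT eqxx andbT; apply/negP => /cover_number_min.
  by rewrite tauG cT ltnn.
have EC : E = ~: O.
  apply/setP => i; have /setP/(_ i) := OET; have /setP/(_ i) := OE0.
  by rewrite !inE; case: (i \in O); case: (i \in E).
have num0 : num_covers G p = 0.
  apply/eqP; rewrite cards_eq0; apply/eqP/setP => T; rewrite !inE.
  by apply/negP => /andP[coverT /eqP/nc_p]; rewrite inE coverT.
(* The bound on $c_m(G)$ gives $\dim[A]_p\le\dim[A]_{p+1}$. *)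
move=> /WLP_injective -/(_ p); case.
  have := card_noncovers G p; rewrite num0 add0n => ->.
  rewrite -(leq_add2l (num_covers G p.+1)) card_noncovers -binS_Catalan addnC.
  by rewrite leq_add2l.
move=> a inj; have [||v [kerv [T cT vT]]] := exists_kernel a char_k _ cardO.
- by rewrite card_ord mul2n -addnn addSnnS leq_addr.
- by rewrite -EC.
(* The kernel equations may fail only at [O] and [E], which are covers and so index no coordinate of
   $[A]_{p+1}$. *)
case/eqP: vT; apply: (inj v) (nc_p T cT) => S.
rewrite inE => /andP[ncS /eqP cS]; apply: kerv => //.
  by apply: contraNneq ncS => ->; case/andP: minO.
by rewrite -EC; apply: contraNneq ncS => ->; case/andP: minE.
Qed.
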